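(* Let $R$ be a semiprime ring, let $I$ be a nonzero ideal of $R$, and let $d:R\to R$ be a multiplicative semiderivation associated with a nonzero epimorphism $g$ of $R$. If $d(x)d(y)\pm xy=0$ for all $x,y\in I$ (that is, either $d(x)d(y)+xy=0$ for all $x,y\in I$, or $d(x)d(y)-xy=0$ for all $x,y\in I$), then $[x,d(x)]=0$ for all $x\in I$.
   Context: Rings are associative and not assumed unital or commutative; ideals are two-sided. A ring $R$ is semiprime if for $x\in R$, $xRx=0$ implies $x=0$. For $x,y\in R$, $[x,y]=xy-yx$. A mapping $d:R\to R$ (not assumed additive) is a multiplicative semiderivation associated with a function $g:R\to R$ if (i) $d(xy)=d(x)g(y)+xd(y)=d(x)y+g(x)d(y)$ and (ii) $d(g(x))=g(d(x))$ hold for all $x,y\in R$. An epimorphism of $R$ is a surjective ring homomorphism $R\to R$; nonzero means not the zero map. *)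

(* Defs.v *)
From HB Require Import structures.
From mathcomp Require Import all_boot ssralg.
Set Implicit Arguments.
Unset Strict Implicit.
Unset Printing Implicit Defensive.

Import GRing.Theory.
Local Open Scope ring_scope.

(* The library's ring structures are all unital, hence a separate structure
   for associative rings in which no unit and no commutativity is assumed. *)
HB.mixin Record Zmodule_isRng R of GRing.Zmodule R := {
  rngmul : R -> R -> R;
  rngmulA : associative rngmul;
  rngmulDl : left_distributive rngmul +%R;
  rngmulDr : right_distributive rngmul +%R
}.

#[short(type="rngType")]
HB.structure Definition Rng := { R of Zmodule_isRng R & GRing.Zmodule R }.

(* A separate symbol: in ring_scope, [*] is the product of the unital rings. *)
Notation "x ** y" := (rngmul x y)
  (at level 40, left associativity) : ring_scope.

Definition semiprime (R : rngType) : Prop :=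
  forall x : R, (forall r : R, x ** r ** x = 0) -> x = 0.

Definition commutator (R : rngType) (x y : R) : R := x ** y - y ** x.

(* Ideals are arbitrary, not necessarily decidable, subsets: hence [Prop]. *)
Record is_ideal (R : rngType) (I : R -> Prop) : Prop := IsIdeal {
  ideal0 : I 0;
  idealB : forall x y : R, I x -> I y -> I (x - y);
  idealMl : forall r x : R, I x -> I (r ** x);
  idealMr : forall x r : R, I x -> I (x ** r)
}.

Definition nonzero_ideal (R : rngType) (I : R -> Prop) : Prop :=
  is_ideal I /\ (exists2 x : R, I x & x <> 0).

(* Epimorphisms are the surjective endomorphisms, not the right-cancellable
   ones. *)
Record is_epimorphism (R : rngType) (g : R -> R) : Prop := IsEpimorphism {
  epiD : {morph g : x y / x + y};
  epiM : {morph g : x y / x ** y};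
  epi_surj : forall y : R, exists x : R, g x = y
}.

Definition nonzero_map (R : rngType) (f : R -> R) : Prop :=
  exists x : R, f x <> 0.

(* [d] is not assumed to be additive. *)
Record multiplicative_semiderivation (R : rngType) (d g : R -> R) : Prop :=
  MultiplicativeSemiderivation {
    semiderMl : forall x y : R, d (x ** y) = d x ** g y + x ** d y;
    semiderMr : forall x y : R, d (x ** y) = d x ** y + g x ** d y;
    semider_comm : forall x : R, d (g x) = g (d x)
  }.

(* Main.v *)
(** Expanding [d x ** d (y ** r)] by the second form of the product rule, and
    comparing with [d x ** d y = x ** y] or [d x ** d y = - (x ** y)] on [I],
    cancels everything except [d x ** g y ** d r], which therefore vanishes for
    [x, y] in [I] and every [r].
    As [g] is onto, [g y ** r] and [r ** g y] are again values of [g] on [I];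
    semiprimeness then gives [d x ** g x = 0 = g x ** d x] on [I], and equating
    the two expansions of [d (x ** x)] yields [x ** d x = d x ** x]. *)
Require Import Defs.
From mathcomp Require Import all_boot ssralg.
Import GRing.Theory.
Local Open Scope ring_scope.

Lemma rngmul0 (R : rngType) (x : R) : x ** 0 = 0.
Proof. by apply: (addrI (x ** 0)); rewrite -rngmulDr !addr0. Qed.

Lemma rng0mul (R : rngType) (x : R) : 0 ** x = 0.
Proof. by apply: (addrI (0 ** x)); rewrite -rngmulDl !addr0. Qed.

Lemma rngmulNl (R : rngType) (x y : R) : (- x) ** y = - (x ** y).
Proof. by apply: (addrI (x ** y)); rewrite -rngmulDl !subrr rng0mul. Qed.

Lemma semider_mul_ideal (R : rngType) (I : R -> Prop) (d g : R -> R) :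
    is_ideal I -> multiplicative_semiderivation d g ->
    (forall x y : R, I x -> I y -> d x ** d y + x ** y = 0) \/
    (forall x y : R, I x -> I y -> d x ** d y - x ** y = 0) ->
  forall x y r : R, I x -> I y -> d x ** g y ** d r = 0.
Proof.
move=> idI dS dI x y r Ix Iy.
have Iyr : I (y ** r) by exact: idealMr.
(* Since [y ** r] stays in [I], both sides are [x ** y ** r] up to the same sign. *)
have dyr : d x ** d (y ** r) = d x ** d y ** r.
  case: dI => dI.
    apply: oppr_inj; rewrite (addr0_eq (dI _ _ Ix Iyr)).
    rewrite -rngmulNl (addr0_eq (dI _ _ Ix Iy)).
    exact: rngmulA.
  move: (subr0_eq (dI _ _ Ix Iyr)) (subr0_eq (dI _ _ Ix Iy)) => -> ->.
  exact: rngmulA.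
apply: (addrI (d x ** d y ** r)).
by rewrite addr0 -{2}dyr (semiderMr dS) rngmulDr !rngmulA.
Qed.

Theorem theorem5 (R : rngType) (I : R -> Prop) (d g : R -> R)
    (R_semiprime : semiprime R)
    (I_ideal : nonzero_ideal I)
    (g_epi : is_epimorphism g)
    (g_neq0 : nonzero_map g)
    (d_semider : multiplicative_semiderivation d g)
    (d_id : (forall x y : R, I x -> I y -> d x ** d y + x ** y = 0) \/
            (forall x y : R, I x -> I y -> d x ** d y - x ** y = 0)) :
  forall x : R, I x -> commutator x (d x) = 0.
Proof.
move=> x Ix; case: I_ideal => idI _.
have dgd := @semider_mul_ideal R I d g idI d_semider d_id.
have dg0 : d x ** g x = 0.
  (* With [r = g s], [g x ** g s = g (x ** s)] and [x ** s] is in [I], so the factor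
     [d x ** g (x ** s) ** d x] is zero. *)
  apply: R_semiprime => r; have [s <-] := epi_surj g_epi r.
  rewrite -(rngmulA (d x)) -(epiM g_epi) rngmulA dgd ?rng0mul //.
  exact: idealMr.
have gd0 : g x ** d x = 0.
  (* Now [g s] merges with the [g x] on its right, and the zero factor is
     [d x ** g (s ** x) ** d x]. *)
  apply: R_semiprime => r; have [s <-] := epi_surj g_epi r.
  rewrite rngmulA -(rngmulA (g x ** d x)) -(epiM g_epi) -!rngmulA.
  rewrite (rngmulA (d x)) dgd ?rngmul0 //.
  exact: idealMl.
have := semiderMl d_semider x x; rewrite (semiderMr d_semider) dg0 gd0.
by rewrite addr0 add0r /commutator => ->; rewrite subrr.
Qed.
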